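(* Let $G$ be a tripartite graph with parts $V_1$, $V_2$ and $V_3$ such that $|V_1|=|V_2|=|V_3|=n>240$. Let $(n^2-n+\alpha' n^{\delta_a})$, $(n^2-n+\beta' n^{\delta_b})$ and $(n^2-n+\gamma' n^{\delta_c})$ be the number of edges of $G[V_1,V_2]$, $G[V_1,V_3]$ and $G[V_2,V_3]$, respectively. If $$\alpha'\beta'\, n^{(\delta_a+\delta_b-1)}+\gamma'\, n^{(\delta_c-1)}>1,$$ $$\gamma'\beta'\, n^{(\delta_c+\delta_b-1)}+\alpha'\, n^{(\delta_a-1)}>1,$$ $$\alpha'\gamma'\, n^{(\delta_a+\delta_c-1)}+\beta'\, n^{(\delta_b-1)}>1,$$ then $G$ contains a triangle-factor.
   Context: For a tripartite graph $G$ with parts $V_1,V_2,V_3$, $G[V_i,V_j]$ denotes the bipartite graph consisting of the edges of $G$ between $V_i$ and $V_j$. The quantities $\alpha',\beta',\gamma',\delta_a,\delta_b,\delta_c$ are real numbers used to express the three edge counts. When $|V_1|=|V_2|=|V_3|=n$, $G$ contains a triangle-factor if it contains $n$ vertex-disjoint triangles.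
   Formalization: The formal theorem also assumes that at least one of α', β', γ' is nonnegative; if all three are negative the claim fails (e.g. n=256, exponents 0, all equal to −17, with one vertex of V_1 having no neighbour in V_2). *)

(* Defs.v *)
From mathcomp Require Import all_boot.

Set Implicit Arguments.
Unset Strict Implicit.
Unset Printing Implicit Defensive.

Record sgraph := SGraph {
  vertex :> finType;
  adj : rel vertex;
  adj_sym : symmetric adj;
  adj_irrefl : irreflexive adj }.

Definition independent (G : sgraph) (A : {set G}) : Prop :=
  {in A &, forall x y, ~~ adj x y}.

Definition tripartition (G : sgraph) (V1 V2 V3 : {set G}) : Prop :=
  [/\ V1 :|: V2 :|: V3 = [set: G],
      [/\ [disjoint V1 & V2], [disjoint V1 & V3] & [disjoint V2 & V3]] &
      [/\ independent V1, independent V2 & independent V3]].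

(* Each edge is represented by the pair (endpoint in A, endpoint in B); this is
   a bijection with unordered edges only because A and B are disjoint. *)
Definition edges_between (G : sgraph) (A B : {set G}) : {set G * G} :=
  [set p in setX A B | adj p.1 p.2].

Definition triangle (G : sgraph) (t : {set G}) : Prop :=
  #|t| = 3 /\ {in t &, forall x y, x != y -> adj x y}.

(* The parameter n is the common size of the three parts. *)
Definition has_triangle_factor (G : sgraph) (n : nat) : Prop :=
  exists F : {set {set G}},
    [/\ #|F| = n, trivIset F & {in F, forall t, triangle t}].

(* Main.v *)
(* Let a, b, c be the numbers of nonadjacent pairs between V1 and V2, V1 and V3,
   V2 and V3.  The hypotheses say that a, b, c < n and that c < (n - a)(n - b),
   b < (n - a)(n - c), a < (n - b)(n - c); the last three force every vertex into
   a triangle.  If every vertex has fewer than T ~ n/4 non-neighbours in each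
   other part, a perfect matching of V1 and V2 minimising the number of bad pairs
   under transpositions has none, and the same argument matches its edges with
   V3.  Otherwise delete a triangle through a vertex with at least T
   non-neighbours in some part.  Since a + b + c < 3n, this happens at most 13
   times, and for n > 240 the triangle can be chosen so that the inequalities
   (or, in one case, a substitute for them) survive. *)

Require Import Defs.
From mathcomp Require Import all_boot all_order all_algebra.
From mathcomp Require Import fingroup perm.
From mathcomp Require Import reals exp.
From mathcomp Require Import zify lra.

Set Implicit Arguments.
Unset Strict Implicit.

(** * Counting nonadjacent pairs *)

Definition nonadj {G : sgraph} (x : G) (A : {set G}) : nat :=
  #|[set y in A | ~~ adj x y]|.

Definition missing {G : sgraph} (A B : {set G}) : nat :=
  \sum_(x in A) nonadj x B.

Lemma nonadjE {G : sgraph} (x : G) (A : {set G}) :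
  nonadj x A = \sum_(y in A) ~~ adj x y.
Proof.
rewrite /nonadj -sum1_card [LHS]big_mkcond [RHS]big_mkcond /=.
by apply: eq_bigr => y _; rewrite inE; case: (y \in A); case: (adj x y).
Qed.

Lemma card_nbrs {G : sgraph} (x : G) (A : {set G}) :
  #|[set y in A | adj x y]| = #|A| - nonadj x A.
Proof.
have -> : [set y in A | adj x y] = A :\: [set y in A | ~~ adj x y].
  by apply/setP => y; rewrite !inE; case: (y \in A); case: (adj x y).
rewrite cardsD /nonadj; congr (_ - #|pred_of_set _|).
by apply/setIidPr/subsetP => y; rewrite inE => /andP[].
Qed.

Lemma missingC {G : sgraph} (A B : {set G}) : missing A B = missing B A.
Proof.
rewrite /missing; under eq_bigr do rewrite nonadjE.
rewrite exchange_big /=; apply: eq_bigr => y _; rewrite nonadjE.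
by apply: eq_bigr => x _; rewrite adj_sym.
Qed.

Lemma nonadj_le_missing {G : sgraph} (x : G) (A B : {set G}) :
  x \in A -> nonadj x B <= missing A B.
Proof. by move=> xA; rewrite /missing (bigD1 x) //= leq_addr. Qed.

Lemma nonadj_le_card {G : sgraph} (x : G) (A : {set G}) : nonadj x A <= #|A|.
Proof. by apply/subset_leq_card/subsetP => y; rewrite inE => /andP[]. Qed.

Lemma missing_sub {G : sgraph} (A A' B B' : {set G}) :
  A' \subset A -> B' \subset B -> missing A' B' <= missing A B.
Proof.
move=> sA sB; rewrite /missing [leqRHS](big_setID A') /= (setIidPr sA).
apply: leq_trans; last exact: leq_addr.
apply: leq_sum => x _.
apply/subset_leq_card/subsetP => y; rewrite !inE => /andP[yB ->].
by rewrite (subsetP sB).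
Qed.

(** The row of [x] and the column of [y] overlap only in the pair [(x, y)], which is adjacent and so
    contributes nothing. *)
Lemma missingD1 {G : sgraph} (A B : {set G}) (x y : G) :
  x \in A -> y \in B -> adj x y ->
  missing A B = nonadj x B + nonadj y A + missing (A :\ x) (B :\ y).
Proof.
move=> xA yB xy.
rewrite {1}/missing (big_setD1 x) //= -addnA; congr (_ + _).
rewrite -/(missing (A :\ x) B) missingC {1}/missing (big_setD1 y) //=.
rewrite -/(missing (B :\ y) (A :\ x)) missingC; congr (_ + _).
by rewrite !nonadjE [RHS](big_setD1 x) //= adj_sym xy add0n.
Qed.

Lemma edge_exists {G : sgraph} (A B A' B' : {set G}) :
  A' \subset A -> B' \subset B -> missing A B < #|A'| * #|B'| ->
  exists x y, [/\ x \in A', y \in B' & adj x y].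
Proof.
move=> sA sB lt.
case: (boolP [exists x in A', [exists y in B', adj x y]]).
  by move=> /exists_inP[x xA /exists_inP[y yB xy]]; exists x, y.
rewrite negb_exists_in => /forall_inP none.
suff : #|A'| * #|B'| <= missing A B by rewrite leqNgt lt.
apply: (leq_trans _ (missing_sub sA sB)); rewrite -sum_nat_const.
apply: leq_sum => x /none; rewrite negb_exists_in => /forall_inP noney.
apply/subset_leq_card/subsetP => y yB.
by rewrite inE yB noney.
Qed.

(** * Perfect matchings in dense relations *)

Lemma perm_of_dense {n : nat} (r : 'I_n -> 'I_n -> bool) :
  (forall i j, #|[set j' | ~~ r i j']| + #|[set i' | ~~ r i' j]| < n) ->
  exists s : {perm 'I_n}, forall i, r i (s i).
Proof.
move=> dense.
pose bad (s : {perm 'I_n}) := [set i | ~~ r i (s i)].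
have [s _ smin] := arg_minnP (fun s : {perm 'I_n} => #|bad s|) (erefl true : xpredT 1%g).
exists s => i; apply/negPn/negP => badi.
(* The two sets of obstructions have fewer than [n] elements together, so some [k] avoids both;
   exchanging the images of [i] and [k] repairs [i] and spoils nothing. *)
have [k] : exists k, ~~ ((~~ r i (s k)) || (~~ r k (s i))).
  apply/existsP; rewrite -negb_forall; apply/negP => /forallP all_bad.
  have := dense i (s i); rewrite ltnNge => /negP; apply.
  have -> : #|[set j' | ~~ r i j']| = #|[set k | ~~ r i (s k)]|.
    rewrite -(card_imset [set k | ~~ r i (s k)] (@perm_inj _ s)).
    congr #|pred_of_set _|; apply/setP => k; rewrite -[k](permKV s).
    by rewrite (mem_imset _ _ (@perm_inj _ s)) !inE.
  rewrite -[n in n <= _]card_ord -cardsT; apply: leq_trans (leq_card_setU _ _).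
  by apply/subset_leq_card/subsetP => k _; rewrite !inE all_bad.
rewrite negb_or !negbK => /andP[rik rki].
have := smin (tperm i k * s)%g isT; rewrite leqNgt => /negP; apply.
apply: proper_card; apply/properP; split.
  apply/subsetP => j; rewrite !inE permM.
  by case: tpermP => [->|->|_ _] //; rewrite ?rik ?rki.
by exists i; rewrite !inE // permM tpermL negbK.
Qed.

(** * Triangle factors of three parts *)

(** The condition on [cover F] keeps a factor of smaller parts disjoint from a deleted triangle, so
    that the triangle can be put back. *)
Definition factor {G : sgraph} (X Y Z : {set G}) : Prop :=
  exists F : {set {set G}},
    [/\ #|F| = #|X|, trivIset F, cover F \subset X :|: Y :|: Z &
        {in F, forall t, triangle t}].

Definition balanced {G : sgraph} (n : nat) (X Y Z : {set G}) : Prop :=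
  [/\ #|X| = n, #|Y| = n, #|Z| = n &
      [/\ [disjoint X & Y], [disjoint X & Z] & [disjoint Y & Z]]].

Lemma balanced_swap12 {G : sgraph} n (X Y Z : {set G}) :
  balanced n X Y Z -> balanced n Y X Z.
Proof. by move=> [? ? ? [? ? ?]]; split=> //; split=> //; rewrite disjoint_sym. Qed.

Lemma balanced_swap23 {G : sgraph} n (X Y Z : {set G}) :
  balanced n X Y Z -> balanced n X Z Y.
Proof. by move=> [? ? ? [? ? ?]]; split=> //; split=> //; rewrite disjoint_sym. Qed.

Lemma factor_swap12 {G : sgraph} n (X Y Z : {set G}) :
  balanced n X Y Z -> factor Y X Z -> factor X Y Z.
Proof.
by move=> [hX hY _ _] [F [? ? ? ?]]; exists F; split; rewrite // ?hX -?hY // [X :|: Y]setUC.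
Qed.

Lemma factor_swap23 {G : sgraph} (X Y Z : {set G}) :
  factor X Z Y -> factor X Y Z.
Proof. by move=> [F [? ? ? ?]]; exists F; split; rewrite // setUAC. Qed.

Lemma triangle3 {G : sgraph} (x y z : G) :
  adj x y -> adj x z -> adj y z -> triangle [set x; y; z].
Proof.
move=> xy xz yz; split.
  have neq u v : adj u v -> u != v.
    by apply: contraTneq => ->; rewrite adj_irrefl.
  by rewrite setUC cardsU1 cards2 !inE ![z == _]eq_sym negb_or !neq.
move=> u v; rewrite !inE.
move=> /orP[/orP[]|] /eqP-> /orP[/orP[]|] /eqP-> //; rewrite ?eqxx //.
all: by rewrite adj_sym.
Qed.

Lemma factor_extend {G : sgraph} n (X Y Z : {set G}) (x y z : G) :
  balanced n X Y Z -> x \in X -> y \in Y -> z \in Z ->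
  adj x y -> adj x z -> adj y z ->
  factor (X :\ x) (Y :\ y) (Z :\ z) -> factor X Y Z.
Proof.
move=> [_ _ _ [dXY dXZ dYZ]] xX yY zZ xy xz yz [F [cF tF sF triF]].
pose t := [set x; y; z].
have tdisj : [disjoint t & cover F].
  rewrite disjoint_sym; apply: disjointWl sF _; rewrite disjoint_sym.
  rewrite disjoint_subset; apply/subsetP => u; rewrite !inE.
  have [xY xZ] := (disjointFr dXY xX, disjointFr dXZ xX).
  have [yX yZ] := (disjointFl dXY yY, disjointFr dYZ yY).
  have [zX zY] := (disjointFl dXZ zZ, disjointFl dYZ zZ).
  by case/orP => [/orP[]|] /eqP->; rewrite eqxx ?xY ?xZ ?yX ?yZ ?zX ?zY ?andbF.
have tF' : t \notin F.
  apply/negP => tF'; have : x \in cover F.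
    by apply/bigcupP; exists t; rewrite // !inE eqxx.
  by rewrite (disjointFr tdisj) // !inE eqxx.
exists (t |: F); split.
- by rewrite cardsU1 tF' cF [RHS](cardsD1 x) xX.
- apply/trivIsetP => A B; rewrite !inE => /orP[/eqP->|AF] /orP[/eqP->|BF].
  + by rewrite eqxx.
  + by move=> _; apply: disjointWr tdisj; apply: bigcup_sup BF.
  + by move=> _; rewrite disjoint_sym; apply: disjointWr tdisj; apply: bigcup_sup AF.
  + exact: (trivIsetP tF).
- rewrite /cover bigcup_setU big_set1 subUset; apply/andP; split.
    by apply/subsetP => u; rewrite !inE => /orP[/orP[]|] /eqP->; rewrite ?xX ?yY ?zZ ?orbT.
  by apply: subset_trans sF _; rewrite !setUSS // subsetDl.
- by move=> u; rewrite !inE => /orP[/eqP->|/triF //]; apply: triangle3.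
Qed.

(** * Numerical conditions and their survival under deletion *)

Definition feasible (n a b c : nat) : Prop :=
  [/\ a < n, b < n & c < n] /\
  [/\ c < (n - a) * (n - b), b < (n - a) * (n - c) & a < (n - b) * (n - c)].

(* [s] is the total number of nonadjacent pairs.  The last bound pays for the at
   most [n - 4 * T] deletions of triangles, each destroying at least [T] pairs. *)
Definition calibrated (T n s : nat) : Prop :=
  [/\ 56 <= T, 4 * T <= n, n <= 4 * T + 16 & s <= (n - 4 * T) * T].

(* Replaces [feasible] when no vertex has [T] non-neighbours across the second
   pair of parts: unlike [feasible] it survives the loss of a triangle that
   leaves [b] unchanged. *)
Definition skewed (T n a b c : nat) : Prop :=
  [/\ a < n, c < n & b < (n - a) * (n - c)] /\
  [/\ 2 * a + 3 * T <= 2 * (n - c) * T & 2 * c + 3 * T <= 2 * (n - a) * T].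

(** A positive [s] forces [4 * T < n], so there is room to lower [n]; both sides of the bound on [s]
    then drop by at least, respectively exactly, [T]. *)
Lemma calibrated_step T n s p s' :
  calibrated T n s -> T <= p -> s' + p <= s -> 0 < s -> calibrated T n.-1 s'.
Proof.
move=> [T56 lo hi hs] Tp le s0.
have lt : 4 * T < n by nia.
split; [lia|lia|lia|].
have -> : n.-1 - 4 * T = (n - 4 * T).-1 by lia.
nia.
Qed.

(** With [A = n - a] and [C = n - c], the deletion lowers [C] by at most 1 and raises [A] by at
    least [T - 1]. In the first linear condition the left side falls by at least [2 * T], the right
    by at most that; in the second the right side does not fall. *)
Lemma skewed_step T n a b c p a' b' c' :
  56 <= T -> 4 * T <= n <= 4 * T + 16 -> b <= 4 * T + 16 ->
  skewed T n a b c -> T <= p -> a' + p = a -> b' <= b -> c' <= c ->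
  skewed T n.-1 a' b' c'.
Proof.
move=> T56 nT bn [[an cn bAC] [hac hca]] Tp aE bb cc.
have [C [cE C1]] : exists C, c + C = n /\ 1 <= C by exists (n - c); lia.
have [A [aE' A1]] : exists A, a + A = n /\ 1 <= A by exists (n - a); lia.
have eA : n - a = A by lia.
have eC : n - c = C by lia.
rewrite eA eC in hac hca bAC.
(* Otherwise [2 * a <= T], against [T <= p <= a]. *)
have C3 : 3 <= C.
  by rewrite ltnNge; apply/negP => C2; have : C * T <= 2 * T; [exact: leq_mul|lia].
have A2 : 2 <= A.
  by rewrite ltnNge; apply/negP => A0; have : A * T <= 1 * T; [exact: leq_mul|lia].
have hA' : n.-1 - a' >= A - 1 + T by lia.
have hC' : n.-1 - c' >= C - 1 by lia.
split; split; try lia.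
- apply: leq_ltn_trans bb _.
  apply: (@leq_trans ((A - 1 + T) * (C - 1))); last exact: leq_mul.
  (* The product must exceed [4 * T + 16]. For [C >= 6] it is at least [5 * (T + 1)]; for smaller
     [C], [hac] bounds [a] and makes [A] a sufficient multiple of [T]. *)
  have [C6|C6] := leqP 6 C.
    have : (1 + T) * 5 <= (A - 1 + T) * (C - 1) by apply: leq_mul; lia.
    lia.
  have : C = 3 \/ C = 4 \/ C = 5 by lia.
  by case=> [|[]] CE; rewrite CE in hac *; lia.
- have : 2 * (C - 1) * T <= 2 * (n.-1 - c') * T by rewrite leq_mul2r; lia.
  rewrite mulnBr mulnBl muln1; lia.
- have : 2 * A * T <= 2 * (n.-1 - a') * T by rewrite leq_mul2r; lia.
  lia.
Qed.

Lemma skewed_init T n a b c :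
  56 <= T -> 4 * T <= n <= 4 * T + 16 -> feasible n a b c ->
  a + 6 <= n -> c + 6 <= n -> skewed T n a b c.
Proof.
move=> T56 nT [[an bn cn] [_ bAC _]] a6 c6; split; split=> //.
- have : 2 * 6 * T <= 2 * (n - c) * T by rewrite leq_mul2r; lia.
  lia.
- have : 2 * 6 * T <= 2 * (n - a) * T by rewrite leq_mul2r; lia.
  lia.
Qed.

(** The two products containing [n - b] gain from the drop of [b] and are at least [5 * T], more
    than any count; only the product bounding [b'] shrinks. *)
Lemma feasible_step_central T n a b c q a' b' c' :
  56 <= T -> 4 * T <= n <= 4 * T + 16 -> feasible n a b c ->
  a + 6 <= n -> c + 6 <= n -> T <= q ->
  b' + q = b -> a' <= a -> c' <= c -> feasible n.-1 a' b' c'.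
Proof.
move=> T56 nT [[an bn cn] [cAB bAC aBC]] a6 c6 Tq bE aa cc.
have [C [cE C6]] : exists C, c + C = n /\ 6 <= C by exists (n - c); lia.
have [A [aE A6]] : exists A, a + A = n /\ 6 <= A by exists (n - a); lia.
have [B [bE' B1]] : exists B, b + B = n /\ 1 <= B by exists (n - b); lia.
have hA' : n.-1 - a' >= A - 1 by lia.
have hB' : n.-1 - b' >= B - 1 + T by lia.
have hC' : n.-1 - c' >= C - 1 by lia.
have eA : n - a = A by lia.
have eB : n - b = B by lia.
have eC : n - c = C by lia.
rewrite eA eB eC in cAB bAC aBC.
split; split; try lia.
- apply: leq_ltn_trans cc _.
  apply: (@leq_trans ((A - 1) * (B - 1 + T))); last exact: leq_mul.
  have : 5 * T <= (A - 1) * (B - 1 + T) by apply: leq_mul; lia.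
  lia.
- apply: (@leq_trans ((A - 1) * (C - 1))); last exact: leq_mul.
  have [x xE] : exists x, A = x + 6 by exists (A - 6); lia.
  have [y yE] : exists y, C = y + 6 by exists (C - 6); lia.
  have -> : (A - 1) * (C - 1) = x * y + 5 * x + 5 * y + 25.
    have -> : A - 1 = x + 5 by lia.
    have -> : C - 1 = y + 5 by lia.
    lia.
  have ACE : A * C = x * y + 6 * x + 6 * y + 36 by rewrite xE yE; lia.
  rewrite ACE in bAC.
  (* The product falls by [A + C - 1]. Either this is at most [T], which the drop of [b] covers, or
     [A + C] is so large that [5 * (A + C) - 35] already exceeds [b']. *)
  have [small|big] := leqP (A + C) (T + 1); lia.
- apply: leq_ltn_trans aa _.
  apply: (@leq_trans ((B - 1 + T) * (C - 1))); last exact: leq_mul.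
  have : T * 5 <= (B - 1 + T) * (C - 1) by apply: leq_mul; lia.
  lia.
Qed.

(** Two counts within 5 of [n] force [c < 25], which is below [T]; the only danger is [b'] reaching
    [n.-1], excluded by hypothesis. *)
Lemma feasible_step_corner T n a b c p a' b' c' :
  56 <= T -> 4 * T <= n <= 4 * T + 16 -> feasible n a b c ->
  n <= a + 5 -> n <= b + 5 -> T <= p ->
  a' + p = a -> b' <= b -> c' <= c -> b' < n.-1 -> feasible n.-1 a' b' c'.
Proof.
move=> T56 nT [[an bn cn] [cAB bAC aBC]] a5 b5 Tp aE bb cc bn'.
have c25 : c < 25.
  apply: leq_trans cAB _; apply: (@leq_trans (5 * 5)) => //; apply: leq_mul; lia.
have hA' : n.-1 - a' >= T by lia.
have hB' : n.-1 - b' >= 1 by lia.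
have hC' : n.-1 - c' >= n - 25 by lia.
split; split; try lia.
- apply: (@leq_trans (T * 1)); last exact: leq_mul.
  lia.
- apply: (@leq_trans (T * (n - 25))); last exact: leq_mul.
  nia.
- have : 1 * (n.-1 - c') <= (n.-1 - b') * (n.-1 - c') by rewrite leq_mul2r hB' orbT.
  lia.
Qed.

(** * The case without vertices of many non-neighbours *)

Lemma enum_of_card {G : sgraph} n (A : {set G}) :
  #|A| = n -> exists f : 'I_n -> G, injective f /\ forall i, f i \in A.
Proof.
move=> hA; exists (fun i => enum_val (cast_ord (esym hA) i)); split.
  by move=> i j /enum_val_inj /cast_ord_inj.
by move=> i; apply: enum_valP.
Qed.

Lemma nonadj_enum {G : sgraph} n (A : {set G}) (f : 'I_n -> G) x :
  injective f -> (forall i, f i \in A) -> #|[set i | ~~ adj x (f i)]| <= nonadj x A.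
Proof.
move=> fI fA; rewrite -(card_imset _ fI); apply/subset_leq_card/subsetP => y.
by case/imsetP => i; rewrite !inE => ni ->; rewrite fA.
Qed.

(** [perm_of_dense] first matches [X] with [Y], then the resulting edges with [Z]. The second use
    adds four counts below [T], whence [4 * T <= n]. *)
Lemma factor_of_low_degree {G : sgraph} T n (X Y Z : {set G}) :
  balanced n X Y Z -> 4 * T <= n ->
  (forall x, x \in X -> nonadj x Y < T /\ nonadj x Z < T) ->
  (forall y, y \in Y -> nonadj y X < T /\ nonadj y Z < T) ->
  (forall z, z \in Z -> nonadj z X < T /\ nonadj z Y < T) ->
  factor X Y Z.
Proof.
move=> [hX hY hZ [dXY dXZ dYZ]] hT lowX lowY lowZ.
have [f [fI fX]] := enum_of_card hX.
have [g [gI gY]] := enum_of_card hY.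
have [h [hI hhZ]] := enum_of_card hZ.
have [|s fs] := @perm_of_dense n (fun i j => adj (f i) (g j)).
  move=> i j.
  have := leq_ltn_trans (nonadj_enum (f i) gI gY) (lowX _ (fX i)).1.
  have := leq_ltn_trans (nonadj_enum (g j) fI fX) (lowY _ (gY j)).1.
  under eq_finset => k do rewrite adj_sym.
  lia.
have [|t ft] := @perm_of_dense n
    (fun i k => adj (f i) (h k) && adj (g (s i)) (h k)).
  move=> i k.
  have split2 (p q : pred 'I_n) :
      #|[set j | ~~ (p j && q j)]| <= #|[set j | ~~ p j]| + #|[set j | ~~ q j]|.
    apply: leq_trans (leq_card_setU _ _).
    by apply/subset_leq_card/subsetP => j; rewrite !inE negb_and.
  have := split2 (fun k => adj (f i) (h k)) (fun k => adj (g (s i)) (h k)).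
  have := split2 (fun i => adj (f i) (h k)) (fun i => adj (g (s i)) (h k)).
  have := leq_ltn_trans (nonadj_enum (f i) hI hhZ) (lowX _ (fX i)).2.
  have := leq_ltn_trans (nonadj_enum (g (s i)) hI hhZ) (lowY _ (gY (s i))).2.
  have := leq_ltn_trans (nonadj_enum (h k) fI fX) (lowZ _ (hhZ k)).1.
  have gsI : injective (g \o s) by apply: inj_comp gI (@perm_inj _ s).
  have := leq_ltn_trans (nonadj_enum (h k) gsI (fun i => gY (s i))) (lowZ _ (hhZ k)).2.
  rewrite /=.
  have symf : [set i0 | ~~ adj (h k) (f i0)] = [set i0 | ~~ adj (f i0) (h k)].
    by apply/setP => j; rewrite !inE adj_sym.
  have symg : [set i0 | ~~ adj (h k) (g (s i0))] = [set i0 | ~~ adj (g (s i0)) (h k)].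
    by apply/setP => j; rewrite !inE adj_sym.
  rewrite symf symg.
  move=> low1 low2 low3 low4 le1 le2.
  have arith a b c d : a < T -> b < T -> c < T -> d < T -> a + b + (c + d) < n by lia.
  by apply: leq_ltn_trans (leq_add le2 le1) _; apply: arith.
pose tri i := [set f i; g (s i); h (t i)].
have triU i j u : u \in tri i -> u \in tri j -> i = j.
  have fg a b : f a <> g b by move=> e; have := disjointFr dXY (fX a); rewrite e gY.
  have fh a b : f a <> h b by move=> e; have := disjointFr dXZ (fX a); rewrite e hhZ.
  have gh a b : g a <> h b by move=> e; have := disjointFr dYZ (gY a); rewrite e hhZ.
  rewrite !inE => /orP[/orP[]|] /eqP-> /orP[/orP[]|] /eqP.
  - by move/fI.
  - by move/fg.
  - by move/fh.
  - by move/esym/fg.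
  - by move/gI/perm_inj.
  - by move/gh.
  - by move/esym/fh.
  - by move/esym/gh.
  - by move/hI/perm_inj.
have triI : injective tri.
  by move=> i j e; apply: (triU i j (f i)); rewrite -?e !inE eqxx.
exists [set tri i | i in 'I_n]; split.
- by rewrite card_imset // card_ord.
- apply/trivIsetP => _ _ /imsetP[i _ ->] /imsetP[j _ ->] neq.
  rewrite disjoint_subset; apply/subsetP => u ui; rewrite inE.
  by apply: contraNN neq => /(triU _ _ _ ui) ->.
- apply/subsetP => u /bigcupP[_ /imsetP[i _ ->]]; rewrite !inE.
  by case/orP => [/orP[]|] /eqP->; rewrite ?fX ?gY ?hhZ ?orbT.
- move=> _ /imsetP[i _ ->]; have /andP[fh gh] := ft i.
  exact: triangle3 (fs i) fh gh.
Qed.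

(** * Finding and deleting triangles; the skewed induction *)

Lemma balanced_step {G : sgraph} n (X Y Z : {set G}) x y z :
  balanced n X Y Z -> x \in X -> y \in Y -> z \in Z ->
  balanced n.-1 (X :\ x) (Y :\ y) (Z :\ z).
Proof.
move=> [hX hY hZ [dXY dXZ dYZ]] xX yY zZ.
split; first by rewrite -hX (cardsD1 x X) xX.
- by rewrite -hY (cardsD1 y Y) yY.
- by rewrite -hZ (cardsD1 z Z) zZ.
split; [apply: disjointW dXY|apply: disjointW dXZ|apply: disjointW dYZ];
  exact: subsetDl.
Qed.

Lemma link_exists {G : sgraph} n (X Y Z : {set G}) x :
  balanced n X Y Z -> missing Y Z < (n - nonadj x Y) * (n - nonadj x Z) ->
  exists y z, [/\ y \in Y, z \in Z, adj x y, adj x z & adj y z].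
Proof.
move=> [_ hY hZ _]; rewrite -{1}hY -{1}hZ -!card_nbrs => /edge_exists.
case; [exact: subsetDl || by apply/subsetP => u; rewrite inE => /andP[] ..|].
move=> y [z []]; rewrite !inE => /andP[yY xy] /andP[zZ xz] yz.
by exists y, z.
Qed.

Definition heavy {G : sgraph} (T : nat) (A B : {set G}) : bool :=
  [exists x in A, T <= nonadj x B] || [exists y in B, T <= nonadj y A].

Lemma heavyC {G : sgraph} T (A B : {set G}) : heavy T A B = heavy T B A.
Proof. by rewrite /heavy orbC. Qed.

Lemma heavyPn {G : sgraph} T (A B : {set G}) : ~~ heavy T A B ->
  (forall x, x \in A -> nonadj x B < T) /\ (forall y, y \in B -> nonadj y A < T).
Proof.
rewrite negb_or !negb_exists_in => /andP[/forall_inP hA /forall_inP hB].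
by split=> x xA; rewrite ltnNge ?hA ?hB.
Qed.

Lemma factor_of_not_heavy {G : sgraph} T n (X Y Z : {set G}) :
  balanced n X Y Z -> 4 * T <= n ->
  ~~ heavy T X Y -> ~~ heavy T X Z -> ~~ heavy T Y Z -> factor X Y Z.
Proof.
move=> bal hT /heavyPn[xy yx] /heavyPn[xz zx] /heavyPn[yz zy].
by apply: (factor_of_low_degree bal hT) => u uA; split; auto.
Qed.

Lemma nonadj_sub {G : sgraph} (x : G) (A B : {set G}) :
  A \subset B -> nonadj x A <= nonadj x B.
Proof.
move=> sAB; apply/subset_leq_card/subsetP => y.
by rewrite !inE => /andP[/(subsetP sAB)-> ->].
Qed.

Definition missing3 {G : sgraph} (X Y Z : {set G}) : nat :=
  missing X Y + missing X Z + missing Y Z.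

Lemma skewed_sym T n a b c : skewed T n a b c -> skewed T n c b a.
Proof. by rewrite /skewed mulnC => -[[? ? ?] [? ?]]. Qed.

Lemma skewed_triangle {G : sgraph} T n (X Y Z : {set G}) :
  balanced n X Y Z -> 2 * T <= n ->
  skewed T n (missing X Y) (missing X Z) (missing Y Z) ->
  ~~ heavy T X Z -> heavy T X Y ->
  exists x y z, [/\ x \in X, y \in Y & z \in Z] /\
    [/\ adj x y, adj x z, adj y z & T <= nonadj x Y + nonadj y X].
Proof.
move=> bal Tn [[an cn bAC] [hac hca]] /heavyPn[lowX lowZ] /orP[] /exists_inP[].
  move=> x xX Tx.
  have le := nonadj_le_missing Y xX.
  have [|y [z [yY zZ xy xz yz]]] := link_exists (x := x) bal.
    (* As X and Z are not heavy, [x] has at least [n - T >= T] neighbours in [Z]; the second linear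
       condition of [skewed] bounds the pairs missing between Y and Z accordingly. *)
    apply: (@leq_trans ((n - missing X Y) * T)).
      have T0 : 0 < T by have := lowX _ xX; lia.
      nia.
    by apply: leq_mul; have := lowX _ xX; lia.
  by exists x, y, z; split; split=> //; lia.
move=> y yY Ty.
have le1 := nonadj_le_missing X yY; rewrite missingC in le1.
have le2 := nonadj_le_missing Z yY.
have [|x [z [xX zZ yx yz xz]]] := link_exists (x := y) (balanced_swap12 bal).
  by apply: leq_trans bAC _; apply: leq_mul; lia.
by exists x, y, z; split; split=> //; rewrite 1?adj_sym //; lia.
Qed.

(** The bound on [missing X Z] is stated in [T] because [n] drops at each deletion while this count
    may stay the same. *)
Lemma skewed_factor {G : sgraph} T n (X Y Z : {set G}) :
  balanced n X Y Z -> calibrated T n (missing3 X Y Z) ->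
  skewed T n (missing X Y) (missing X Z) (missing Y Z) ->
  missing X Z <= 4 * T + 16 -> ~~ heavy T X Z -> factor X Y Z.
Proof.
elim: n X Y Z => [|n IH] X Y Z bal cal; first by case: cal; lia.
have [T56 lo hi tot] := cal => skew bT nXZ.
have step x y z : [/\ x \in X, y \in Y & z \in Z] ->
    adj x y -> adj x z -> adj y z ->
    T <= nonadj x Y + nonadj y X \/ T <= nonadj z Y + nonadj y Z ->
    factor X Y Z.
  move=> [xX yY zZ] xy xz yz big.
  apply: (factor_extend bal xX yY zZ xy xz yz).
  have e1 := missingD1 xX yY xy.
  have e2 := missingD1 xX zZ xz.
  have e3 := missingD1 yY zZ yz.
  have T0 : 0 < T by lia.
  have nT : 4 * T <= n.+1 <= 4 * T + 16 by lia.
  apply: IH.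
  - exact: balanced_step bal xX yY zZ.
  - apply: (@calibrated_step T n.+1 (missing3 X Y Z) T) => //; rewrite /missing3.
      by case: big => big; lia.
    by case: big => big; lia.
  - case: big => big.
      apply: (@skewed_step T n.+1 (missing X Y) (missing X Z) (missing Y Z)
                (nonadj x Y + nonadj y X)) => //; lia.
    apply: skewed_sym.
    apply: (@skewed_step T n.+1 (missing Y Z) (missing X Z) (missing X Y)
                (nonadj z Y + nonadj y Z)) => //; try lia.
    exact: skewed_sym.
  - by apply: leq_trans bT; lia.
  - apply: contraNN nXZ => /orP[] /exists_inP[u]; rewrite !inE => /andP[_ uA] Tu;
      apply/orP; [left|right]; apply/exists_inP; exists u => //;
      by apply: leq_trans Tu _; apply: nonadj_sub; rewrite subsetDl.
have [hXY|nXY] := boolP (heavy T X Y).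
  have [|x [y [z [mem [xy xz yz big]]]]] := skewed_triangle bal _ skew nXZ hXY.
    by lia.
  by apply: step mem xy xz yz _; left.
have [hYZ|nYZ] := boolP (heavy T Y Z).
  have bal' := balanced_swap12 (balanced_swap23 (balanced_swap12 bal)).
  have skew' := skewed_sym skew.
  rewrite missingC [missing X Z]missingC [missing X Y]missingC in skew'.
  rewrite heavyC in nXZ; rewrite heavyC in hYZ.
  have [|z [y [x [[zZ yY xX] [zy zx yx big]]]]] := skewed_triangle bal' _ skew' nXZ hYZ.
    by lia.
  by apply: (step x y z); rewrite 1?adj_sym //; right.
by apply: factor_of_not_heavy bal _ nXY nXZ nYZ; lia.
Qed.

(** * The main induction: central and corner cases *)

Lemma feasible_swap12 n a b c : feasible n a b c -> feasible n a c b.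
Proof. by move=> [[? ? ?] [? ? ?]]; split; split; rewrite // mulnC. Qed.

Lemma feasible_swap23 n a b c : feasible n a b c -> feasible n b a c.
Proof. by move=> [[? ? ?] [? ? ?]]; split; split; rewrite // mulnC. Qed.

Definition good {G : sgraph} (T n : nat) (X Y Z : {set G}) : Prop :=
  [/\ balanced n X Y Z, calibrated T n (missing3 X Y Z) &
      feasible n (missing X Y) (missing X Z) (missing Y Z)].

Lemma good_swap12 {G : sgraph} T n (X Y Z : {set G}) :
  good T n X Y Z -> good T n Y X Z.
Proof.
move=> [bal cal fea]; split; first exact: balanced_swap12.
  suff -> : missing3 Y X Z = missing3 X Y Z by [].
  by rewrite /missing3 [missing Y X]missingC addnAC.
by rewrite missingC; apply: feasible_swap12.
Qed.

Lemma good_swap23 {G : sgraph} T n (X Y Z : {set G}) :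
  good T n X Y Z -> good T n X Z Y.
Proof.
move=> [bal cal fea]; split; first exact: balanced_swap23.
  by move: cal; rewrite /missing3 [missing Z Y]missingC [missing X Z + _]addnC.
by rewrite [missing Z Y]missingC; apply: feasible_swap23.
Qed.

Lemma good_link {G : sgraph} T n (X Y Z : {set G}) x :
  good T n X Y Z -> x \in X ->
  exists y z, [/\ y \in Y, z \in Z, adj x y, adj x z & adj y z].
Proof.
move=> [bal _ [_ [cAB _ _]]] xX; apply: (link_exists bal).
apply: leq_trans cAB _; apply: leq_mul; apply: leq_sub2l; exact: nonadj_le_missing.
Qed.

Lemma good_triangle {G : sgraph} T n (X Y Z : {set G}) :
  good T n X Y Z -> heavy T X Y ->
  exists x y z, [/\ x \in X, y \in Y & z \in Z] /\
    [/\ adj x y, adj x z, adj y z & T <= nonadj x Y + nonadj y X].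
Proof.
move=> gd /orP[] /exists_inP[].
  move=> x xX Tx; have [y [z [yY zZ xy xz yz]]] := good_link gd xX.
  by exists x, y, z; split; split=> //; lia.
move=> y yY Ty; have [x [z [xX zZ yx yz xz]]] := good_link (good_swap12 gd) yY.
by exists x, y, z; split; split=> //; rewrite 1?adj_sym //; lia.
Qed.

Lemma good_delete {G : sgraph} T n (X Y Z : {set G}) x y z :
  good T n X Y Z ->
  (forall X' Y' Z' : {set G}, good T n.-1 X' Y' Z' -> factor X' Y' Z') ->
  [/\ x \in X, y \in Y & z \in Z] -> adj x y -> adj x z -> adj y z ->
  T <= nonadj x Y + nonadj y X ->
  (missing (X :\ x) (Y :\ y) + (nonadj x Y + nonadj y X) = missing X Y ->
   missing (X :\ x) (Z :\ z) + (nonadj x Z + nonadj z X) = missing X Z ->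
   missing (Y :\ y) (Z :\ z) + (nonadj y Z + nonadj z Y) = missing Y Z ->
   feasible n.-1 (missing (X :\ x) (Y :\ y)) (missing (X :\ x) (Z :\ z))
     (missing (Y :\ y) (Z :\ z))) ->
  factor X Y Z.
Proof.
move=> [bal cal _] IH [xX yY zZ] xy xz yz big fea.
apply: (factor_extend bal xX yY zZ xy xz yz); apply: IH.
have e1 := missingD1 xX yY xy.
have e2 := missingD1 xX zZ xz.
have e3 := missingD1 yY zZ yz.
have [T56 _ _ _] := cal.
split; first exact: balanced_step bal xX yY zZ.
  by apply: (calibrated_step cal (leqnn T)); rewrite /missing3; lia.
by apply: fea; lia.
Qed.

(** If [X] and [Y] are heavy, a deletion preserves feasibility; if not, the slack of 6 in the other
    two counts starts the skewed induction with [X], [Y] as the light pair. *)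
Lemma factor_central {G : sgraph} T n (X Y Z : {set G}) :
  good T n X Y Z ->
  (forall X' Y' Z' : {set G}, good T n.-1 X' Y' Z' -> factor X' Y' Z') ->
  missing X Z + 6 <= n -> missing Y Z + 6 <= n -> factor X Y Z.
Proof.
move=> gd IH b6 c6; have [bal cal fea] := gd; have [T56 lo hi _] := cal.
have nT : 4 * T <= n <= 4 * T + 16 by lia.
have [hXY|nXY] := boolP (heavy T X Y).
  have [x [y [z [mem [xy xz yz big]]]]] := good_triangle gd hXY.
  apply: (good_delete gd IH mem xy xz yz big) => e1 e2 e3.
  apply: feasible_swap23.
  apply: (feasible_step_central T56 nT (feasible_swap23 fea) b6 c6 big e1); lia.
apply: (factor_swap23); apply: (@skewed_factor _ T n) => //.
- exact: balanced_swap23.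
- by have [] := good_swap23 gd.
- rewrite [missing Z Y]missingC; apply: skewed_init => //.
  exact: feasible_swap23.
- have [[]] := fea; lia.
Qed.

Lemma factor_corner_slack {G : sgraph} T n (X Y Z : {set G}) :
  good T n X Y Z ->
  (forall X' Y' Z' : {set G}, good T n.-1 X' Y' Z' -> factor X' Y' Z') ->
  n <= missing X Y + 5 -> n <= missing X Z + 5 ->
  heavy T X Y -> missing X Z + 2 <= n -> factor X Y Z.
Proof.
move=> gd IH a5 b5 hXY b2; have [bal cal fea] := gd; have [T56 lo hi _] := cal.
have nT : 4 * T <= n <= 4 * T + 16 by lia.
have [x [y [z [mem [xy xz yz big]]]]] := good_triangle gd hXY.
apply: (good_delete gd IH mem xy xz yz big) => e1 e2 e3.
apply: (feasible_step_corner T56 nT fea a5 b5 big e1); lia.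
Qed.

Lemma factor_corner_heavy {G : sgraph} T n (X Y Z : {set G}) :
  good T n X Y Z ->
  (forall X' Y' Z' : {set G}, good T n.-1 X' Y' Z' -> factor X' Y' Z') ->
  n <= missing X Y + 5 -> n <= missing X Z + 5 ->
  heavy T X Y -> factor X Y Z.
Proof.
move=> gd IH a5 b5 hXY.
have [b2|b1] := leqP (missing X Z + 2) n; first exact: factor_corner_slack gd IH a5 b5 hXY b2.
have [bal cal fea] := gd; have [T56 lo hi _] := cal.
have nT : 4 * T <= n <= 4 * T + 16 by lia.
have [[an bn cn] [cAB bAC aBC]] := fea.
have b1' : n - missing X Z = 1 by lia.
rewrite b1' muln1 in cAB.
(* As [n - b = 1], the deleted triangle must also destroy a pair between X and Z. *)
have [_ hY hZ _] := bal.
have hit x y z : [/\ x \in X, y \in Y & z \in Z] ->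
    adj x y -> adj x z -> adj y z -> T <= nonadj x Y + nonadj y X ->
    0 < nonadj x Z + nonadj z X -> factor X Y Z.
  move=> mem xy xz yz big pos.
  apply: (good_delete gd IH mem xy xz yz big) => e1 e2 e3.
  by apply: (feasible_step_corner T56 nT fea a5 b5 big e1); lia.
have all_adj x A z : nonadj x A = 0 -> z \in A -> adj x z.
  move=> /eqP; rewrite cards_eq0 => /eqP/setP/(_ z); rewrite !inE => e zA.
  by move: e; rewrite zA /=; case: (adj x z).
case/orP: (hXY) => /exists_inP[].
  move=> x xX Tx.
  have [d0|dpos] := posnP (nonadj x Z); last first.
    have [y [z [yY zZ xy xz yz]]] := good_link gd xX.
    by apply: (hit x y z) => //; lia.
  (* Here [x] sees all of [Z], so aim for a [z] with a non-neighbour in [X]. Fewer than [n - a]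
     pairs are missing between Y and Z, so [z] has a neighbour among those of [x] in [Y]. *)
  have [z zZ dz] : exists2 z, z \in Z & 0 < nonadj z X.
    apply/exists_inP; rewrite -[[exists _ in _, _]]negbK negb_exists_in.
    apply/negP => /forall_inP none.
    suff : missing X Z = 0 by lia.
    by rewrite missingC /missing big1 // => z /none; rewrite lt0n negbK => /eqP.
  have [|||y [u [yN /set1P-> yz]]] :=
    @edge_exists _ Y Z [set y in Y | adj x y] [set z].
  - by apply/subsetP => u; rewrite inE => /andP[].
  - by rewrite sub1set.
  - rewrite card_nbrs hY cards1 muln1; apply: leq_trans cAB _.
    by apply: leq_sub2l; apply: nonadj_le_missing.
  move: yN; rewrite inE => /andP[yY xy].
  have xz : adj x z by apply: all_adj d0 zZ.
  by apply: (hit x y z) => //; lia.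
move=> y yY Ty.
have [x [z [xX zZ yx yz xz]]] := good_link (good_swap12 gd) yY.
have xy : adj x y by rewrite adj_sym.
have [d0|dpos] := posnP (nonadj x Z + nonadj z X); last first.
  by apply: (hit x y z) => //; lia.
have dx0 : nonadj x Z = 0 by lia.
(* Since [x] sees all of [Z], any neighbour [u] of [y] in [Z] may replace [z]. *)
have [/exists_inP[u]|] := boolP [exists u in [set u in Z | adj y u], 0 < nonadj u X].
  rewrite inE => /andP[uZ yu] du.
  have xu : adj x u by apply: all_adj dx0 uZ.
  apply: (hit x y u) => //; last by rewrite addn_gt0 du orbT.
  exact: leq_trans Ty (leq_addl _ _).
rewrite negb_exists_in => /forall_inP none.
have few : nonadj y Z <= missing Y Z by apply: nonadj_le_missing.
(* Every pair missing between X and Z now involves a non-neighbour of [y] in [Z], and there are at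
   most [missing Y Z] of these. *)
have few_rows K : (forall u, u \in Z -> nonadj u X <= K) ->
    missing X Z <= missing Y Z * K.
  move=> leK; rewrite missingC {1}/missing (big_setID [set u in Z | adj y u]) /=.
  rewrite big1 ?add0n; last first.
    move=> u; rewrite inE => /andP[_ /none].
    by rewrite lt0n negbK => /eqP.
  apply: (@leq_trans (nonadj y Z * K)); last by rewrite leq_mul2r few orbT.
  have -> : nonadj y Z = #|Z :\: [set u in Z | adj y u]|.
    rewrite /nonadj; congr #|pred_of_set _|; apply/setP => u; rewrite !inE.
    by case: (u \in Z); case: (adj y u).
  rewrite -sum_nat_const; apply: leq_sum => u.
  by rewrite inE => /andP[_ /leK].
have c0 : 0 < missing Y Z.
  have := few_rows n; case: (posnP (missing Y Z)) => // ->.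
  have [hX _ _ _] := bal.
  have bnd u : u \in Z -> nonadj u X <= n by rewrite -hX => _; apply: nonadj_le_card.
  by move=> /(_ bnd); lia.
(* From [0 < c < n - a] follows [a + 2 <= n]: the slack case applies with Y and Z exchanged. *)
have [hXZ|/heavyPn[_ lowZ]] := boolP (heavy T X Z).
  by apply: factor_swap23; apply: factor_corner_slack (good_swap23 gd) IH b5 a5 hXZ _; lia.
(* As [c < n - a <= 5], at most [4 * (T - 1)] pairs are missing between X and Z, against [n - 1]. *)
have := few_rows T.-1.
have : missing Y Z * T.-1 <= 4 * T.-1 by rewrite leq_mul2r; lia.
have lowZ' u : u \in Z -> nonadj u X <= T.-1 by move=> /lowZ; lia.
by move=> ? /(_ lowZ'); lia.
Qed.

(** Y and Z are never heavy here: fewer than 25 pairs are missing between them, and [T >= 56]. *)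
Lemma factor_corner {G : sgraph} T n (X Y Z : {set G}) :
  good T n X Y Z ->
  (forall X' Y' Z' : {set G}, good T n.-1 X' Y' Z' -> factor X' Y' Z') ->
  n <= missing X Y + 5 -> n <= missing X Z + 5 -> factor X Y Z.
Proof.
move=> gd IH a5 b5.
have [hXY|nXY] := boolP (heavy T X Y); first exact: factor_corner_heavy gd IH a5 b5 hXY.
have [hXZ|nXZ] := boolP (heavy T X Z).
  exact/factor_swap23/(factor_corner_heavy (good_swap23 gd) IH b5 a5 hXZ).
have [bal [T56 lo _ _] [[an bn cn] [cAB _ _]]] := gd.
apply: factor_of_not_heavy bal lo nXY nXZ _.
have c25 : missing Y Z < 25.
  apply: leq_trans cAB _; apply: (@leq_trans (5 * 5)) => //; apply: leq_mul; lia.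
apply/negP => /orP[] /exists_inP[u uA]; apply/negP; rewrite -ltnNge.
  by have := nonadj_le_missing Z uA; lia.
by have := nonadj_le_missing Y uA; rewrite missingC; lia.
Qed.

Lemma good_factor {G : sgraph} T n (X Y Z : {set G}) :
  good T n X Y Z -> factor X Y Z.
Proof.
elim: n X Y Z => [|n IH] X Y Z gd; first by case: gd => _ []; lia.
have gd213 := good_swap12 gd; have gd132 := good_swap23 gd.
have gd231 := good_swap23 gd213; have gd312 := good_swap12 gd132.
have [bal _ _] := gd; have [bal132 _ _] := gd132.
have from213 : factor Y X Z -> factor X Y Z by apply: factor_swap12 bal.
have from231 : factor Y Z X -> factor X Y Z by move=> /factor_swap23.
have from312 : factor Z X Y -> factor X Y Z.
  by move=> /(factor_swap12 bal132)/factor_swap23.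
have central := @factor_central G T n.+1.
have corner := @factor_corner G T n.+1.
have eYX := missingC Y X; have eZX := missingC Z X; have eZY := missingC Z Y.
(* Two of the three counts lie on the same side of the threshold: two with slack 6 give the central
   case, two without it the corner case. *)
have [a6|a5] := leqP (missing X Y + 6) n.+1;
  have [b6|b5] := leqP (missing X Z + 6) n.+1;
  have [c6|c5] := leqP (missing Y Z + 6) n.+1.
- by apply: central gd IH _ _; lia.
- by apply: from231; apply: central gd231 IH _ _; lia.
- by apply: factor_swap23; apply: central gd132 IH _ _; lia.
- by apply: from312; apply: corner gd312 IH _ _; lia.
- by apply: central gd IH _ _; lia.
- by apply: from213; apply: corner gd213 IH _ _; lia.
- by apply: corner gd IH _ _; lia.
- by apply: corner gd IH _ _; lia.
Qed.

Lemma factor_of_feasible {G : sgraph} n (X Y Z : {set G}) :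
  240 < n -> balanced n X Y Z ->
  feasible n (missing X Y) (missing X Z) (missing Y Z) -> factor X Y Z.
Proof.
move=> n240 bal fea; have [[an bn cn] _] := fea.
(* The 13 leaves room for 13 deletions: at most [3 * (n - 1) <= 12 * T + 45 <= 13 * T] pairs are
   missing. From [n > 240] follows [T >= 57]. *)
have [T [lo hi]] : exists T, 4 * T + 13 <= n /\ n <= 4 * T + 16.
  exists ((n - 13) %/ 4).
  by have := divn_eq (n - 13) 4; have := ltn_pmod (n - 13) (isT : 0 < 4); lia.
apply: (@good_factor G T n); split=> //.
split; [lia|lia|lia|].
apply: (@leq_trans (13 * T)); first by rewrite /missing3; lia.
by rewrite leq_mul2r; lia.
Qed.

(** * From real edge counts to feasibility *)

Lemma card_edges_between {G : sgraph} (A B : {set G}) :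
  #|edges_between A B| + missing A B = #|A| * #|B|.
Proof.
have -> : #|edges_between A B| = \sum_(x in A) #|[set y in B | adj x y]|.
  under [RHS]eq_bigr do rewrite -sum1dep_card.
  rewrite pair_big_dep sum1dep_card; congr #|pred_of_set _|.
  by apply/setP => -[x y]; rewrite !inE /= andbA.
rewrite /missing -big_split /= -sum_nat_const; apply: eq_bigr => x _.
by rewrite card_nbrs subnK // nonadj_le_card.
Qed.

Unset Implicit Arguments.
Set Strict Implicit.

Import Order.TTheory GRing.Theory Num.Theory.
Local Open Scope ring_scope.

(** As [y] and [z] are at most [N], both [x * y] and [x * z] are positive, so [x >= 0] settles all
    signs. *)
Lemma all_positive (R : realFieldType) (N x y z : R) :
  y <= N -> z <= N -> 0 <= x -> x * y + z > N -> x * z + y > N ->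
  [/\ 0 < x, 0 < y & 0 < z].
Proof.
move=> yN zN x0 h1 h3.
have xy : 0 < x * y by lra.
have xz : 0 < x * z by lra.
have x1 : 0 < x.
  by rewrite lt0r x0 andbT; apply: contraTneq xy => ->; rewrite mul0r ltxx.
by rewrite !pmulr_rgt0 // in xy xz.
Qed.

Lemma feasible_of_real (R : realFieldType) (n a b c : nat) :
  let x : R := n%:R - a%:R in let y : R := n%:R - b%:R in let z : R := n%:R - c%:R in
  0 <= x \/ 0 <= y \/ 0 <= z ->
  x * y + z > n%:R -> z * y + x > n%:R -> x * z + y > n%:R ->
  feasible n a b c.
Proof.
move=> x y z sgn h1 h2 h3.
have [xN yN zN] : [/\ x <= n%:R, y <= n%:R & z <= n%:R].
  by split; rewrite gerBl ler0n.
have [x0 y0 z0] : [/\ 0 < x, 0 < y & 0 < z].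
  case: sgn => [x0|[y0|z0]]; first exact: all_positive yN zN x0 h1 h3.
    have h1' : y * x + z > n%:R by rewrite mulrC.
    have h2' : y * z + x > n%:R by rewrite mulrC.
    by have [] := all_positive _ _ _ _ _ xN zN y0 h1' h2'.
  have h3' : z * x + y > n%:R by rewrite mulrC.
  by have [] := all_positive _ _ _ _ _ xN yN z0 h3' h2.
have [an bn cn] : [/\ (a < n)%N, (b < n)%N & (c < n)%N].
  by split; rewrite -(ltr_nat R) -subr_gt0.
split; split=> //; rewrite -(ltr_nat R) natrM !natrB 1?ltnW // -/x -/y -/z.
- by move: h1; rewrite /z; lra.
- by move: h3; rewrite /y; lra.
- by move: h2; rewrite /x mulrC; lra.
Qed.

Lemma powR_split (R : realType) (N p q dp dq : R) : 0 < N ->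
  p * q * N `^ (dp + dq - 1) = (p * N `^ dp) * (q * N `^ dq) / N.
Proof.
move=> N0; rewrite !powRD ?(gt_eqF N0) ?implybT // powR_inv1 ?ltW //.
by rewrite mulrA mulrACA.
Qed.

(* The sign hypothesis only excludes the case where alpha', beta' and gamma' are
   all negative, in which the three inequalities do not imply the conclusion:
   take n = 256, exponents 0 and alpha' = beta' = gamma' = -17, with one vertex
   of V1 having no neighbour in V2. *)
Theorem theorem1p5 (R : realType) (G : sgraph) (V1 V2 V3 : {set G}) (n : nat)
    (alpha' beta' gamma' delta_a delta_b delta_c : R)
    (hpart : tripartition V1 V2 V3)
    (hV1 : #|V1| = n) (hV2 : #|V2| = n) (hV3 : #|V3| = n)
    (hn : (240 < n)%N)
    (hsign : 0 <= alpha' \/ 0 <= beta' \/ 0 <= gamma')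
    (hab : #|edges_between V1 V2|%:R
             = n%:R ^+ 2 - n%:R + alpha' * n%:R `^ delta_a)
    (hac : #|edges_between V1 V3|%:R
             = n%:R ^+ 2 - n%:R + beta' * n%:R `^ delta_b)
    (hbc : #|edges_between V2 V3|%:R
             = n%:R ^+ 2 - n%:R + gamma' * n%:R `^ delta_c)
    (h1 : alpha' * beta' * n%:R `^ (delta_a + delta_b - 1)
            + gamma' * n%:R `^ (delta_c - 1) > 1)
    (h2 : gamma' * beta' * n%:R `^ (delta_c + delta_b - 1)
            + alpha' * n%:R `^ (delta_a - 1) > 1)
    (h3 : alpha' * gamma' * n%:R `^ (delta_a + delta_c - 1)
            + beta' * n%:R `^ (delta_b - 1) > 1) :
  has_triangle_factor G n.
Proof.
have [_ disj _] := hpart.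
have n0 : 0 < n%:R :> R by rewrite ltr0n; apply: leq_trans hn.
have nn : n%:R != 0 :> R by rewrite gt_eqF.
(* Each term added to [n^2 - n] is [n] minus a number of missing pairs, which eliminates the
   exponents once the hypotheses are multiplied by [n]. *)
have deficit (A B : {set G}) (p : R) : #|A| = n -> #|B| = n ->
    #|edges_between A B|%:R = n%:R ^+ 2 - n%:R + p ->
    p = n%:R - (missing A B)%:R.
  move=> hA hB e; have := congr1 (fun m => m%:R : R) (card_edges_between A B).
  by rewrite hA hB natrD natrM e expr2; lra.
have powR_pred p d : p * n%:R `^ (d - 1) = p * n%:R `^ d / n%:R :> R.
  by rewrite powRD ?nn ?implybT // powR_inv1 ?ler0n // mulrA.
have clear_den u v : (1 < u / n%:R + v / n%:R :> R) = (n%:R < u + v).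
  by rewrite -mulrDl ltr_pdivlMr // mul1r.
rewrite (powR_split _ _ _ _ _ _ n0) (powR_pred gamma' delta_c) clear_den in h1.
rewrite (powR_split _ _ _ _ _ _ n0) (powR_pred alpha' delta_a) clear_den in h2.
rewrite (powR_split _ _ _ _ _ _ n0) (powR_pred beta' delta_b) clear_den in h3.
have sgn p d : 0 <= p -> 0 <= p * n%:R `^ d :> R.
  by move=> p0; rewrite mulr_ge0 // powR_ge0.
rewrite (deficit _ _ _ hV1 hV2 hab) (deficit _ _ _ hV1 hV3 hac)
  (deficit _ _ _ hV2 hV3 hbc) in h1 h2 h3.
have fea : feasible n (missing V1 V2) (missing V1 V3) (missing V2 V3).
  apply: (feasible_of_real R) h1 h2 h3.
  rewrite -(deficit _ _ _ hV1 hV2 hab) -(deficit _ _ _ hV1 hV3 hac).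
  rewrite -(deficit _ _ _ hV2 hV3 hbc).
  by case: hsign => [/sgn|[/sgn|/sgn]] h; [left|right; left|right; right].
have bal : balanced n V1 V2 V3 by split.
by have [F [cF tF _ triF]] := factor_of_feasible hn bal fea; exists F; rewrite cF hV1.
Qed.
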